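(* Let $R$ be a ring and let $0\to A_R \xrightarrow{f} B_R \xrightarrow{g} C_R \to 0$ be a cochain complex of right $R$-modules and right $R$-module morphisms (i.e. $gf=0$). The following conditions are equivalent: (a) The sequence $0\to P(A_R) \xrightarrow{P(f)} P(B_R) \xrightarrow{P(g)} P(C_R) \to 0$ is a short exact sequence in $\mathrm{Spec}(\mathrm{Mod}\text{-}R)$. (b) $f$ is a monomorphism in $\mathrm{Mod}\text{-}R$, $f(A_R)$ is an essential submodule of $\ker(g)$, and if $B'_R$ is a complement of $f(A_R)$ in $B_R$, then $g(B'_R)$ is essential in $C_R$.
   Context: Rings are associative with identity $1\neq 0$, not necessarily commutative; modules are unitary right modules. A submodule $N\le M$ is essential in $M$ (written $N\le_e M$) if $N\cap X\neq 0$ for every nonzero submodule $X$ of $M$. A complement of a submodule $K$ in a module $M$ is a submodule $C\le M$ with $K\cap C=0$ and $K\oplus C$ essential in $M$ (for example, any $C$ maximal among the submodules $X$ of $M$ with $K\cap X=0$). The spectral category $\mathrm{Spec}(\mathrm{Mod}\text{-}R)$ (Gabriel–Oberst) has the same objects as $\mathrm{Mod}\text{-}R$, and $\mathrm{Hom}_{\mathrm{Spec}(\mathrm{Mod}\text{-}R)}(A,B)=\varinjlim \mathrm{Hom}_R(A',B)$, where the direct limit is over the downward directed set of essential submodules $A'\le_e A$, with transition maps given by restriction. The composite of the classes of $f\colon A'\to B$ and $g\colon B'\to C$ (with $A'\le_e A$, $B'\le_e B$) is the class of $g\circ f$ restricted to $f^{-1}(B')$, which is essential in $A$. It is a Grothendieck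 category in which every short exact sequence splits. The canonical functor $P\colon\mathrm{Mod}\text{-}R\to\mathrm{Spec}(\mathrm{Mod}\text{-}R)$ is the identity on objects and sends a morphism $f\colon A\to B$ to its class in the direct limit; it is left exact and sends essential monomorphisms to isomorphisms. *)

(* Defs.v *)
From HB Require Import structures.
From mathcomp Require Import all_boot all_algebra all_classical.

Set Implicit Arguments.
Unset Strict Implicit.
Unset Printing Implicit Defensive.

Import GRing.Theory.
Local Open Scope ring_scope.
Local Open Scope classical_set_scope.
Local Open Scope quotient_scope.

(* Right R-modules are left modules over the converse ring R^c: for r : R^c,
   [r *: x] stands for x r. *)
Notation rmodType R := (lmodType R^c).

Section Submodules.
Context {R : nzRingType}.
Implicit Types M : rmodType R.

Definition is_submod M (N : set M) : Prop := submod_closed [in N].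

Definition nonzero M (X : set M) : Prop := exists2 x, X x & x != 0.

(* N is an essential submodule of L; both are given as subsets of M, where L is
   itself meant to be a submodule. *)
Definition essential M (N L : set M) : Prop :=
  [/\ is_submod N, N `<=` L &
      forall X : set M, is_submod X -> X `<=` L -> nonzero X ->
        nonzero (N `&` X)].

Definition complement M (K C : set M) : Prop :=
  [/\ is_submod C, K `&` C = [set 0] &
      essential [set k + c | k in K & c in C] setT].

Record submodule M := Submodule {
  submod_set :> set M;
  submodP : is_submod submod_set }.

Definition is_mono M M' (f : {linear M -> M'}) : Prop :=
  forall (X : rmodType R) (u v : {linear X -> M}), f \o u = f \o v -> u =1 v.

Lemma submodE M (N : set M) : is_submod N <->
  N 0 /\ forall (r : R^c) u v, N u -> N v -> N (r *: u + v).
Proof.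
split=> [[/set_mem N0 Nlin]|[N0 Nlin]].
  by split=> // r u v /mem_set Nu /mem_set Nv; apply: set_mem; apply: Nlin.
split; first exact: mem_set.
by move=> r u v /set_mem Nu /set_mem Nv; apply/mem_set/Nlin.
Qed.

Lemma submodT M : is_submod [set: M].
Proof. by apply/submodE. Qed.

Lemma submodI M (N L : set M) :
  is_submod N -> is_submod L -> is_submod (N `&` L).
Proof.
move=> /submodE[N0 Nl] /submodE[L0 Ll]; apply/submodE; split=> //.
by move=> r u v [? ?] [? ?]; split; [apply: Nl | apply: Ll].
Qed.

Lemma essentialT M : essential [set: M] [set: M].
Proof. by split=> [|//|X _ _ [x Xx x0]]; [exact: submodT | exists x]. Qed.

Lemma essentialI M (N L : set M) :
  essential N setT -> essential L setT -> essential (N `&` L) setT.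
Proof.
move=> [Nm _ Ne] [Lm _ Le]; split=> // [|X Xm _ X0]; first exact: submodI.
rewrite -setIA; apply: Ne => //; first exact: submodI.
exact: Le.
Qed.
End Submodules.

Section SubmoduleType.
Variables (R : nzRingType) (M : rmodType R) (N : submodule M).

Inductive submod_of : predArgType := Submod x & x \in (N : set M).

Definition submod_val (u : submod_of) := let: Submod x _ := u in x.
HB.instance Definition _ := [isSub of submod_of for submod_val].
HB.instance Definition _ := [Choice of submod_of by <:].

HB.instance Definition _ :=
  GRing.SubChoice_isSubLmodule.Build R^c M [in (N : set M)] submod_of
    (GRing.submod_closed_semi (submodP N)).
End SubmoduleType.

Section PartialMorphisms.
Context {R : nzRingType}.
Implicit Types A B C : rmodType R.

(* An element of the disjoint union of the groups Hom(A', B), A' essential in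
   A. *)
Record pmorph A B := PMorph {
  pdom : submodule A;
  pdom_essential : essential pdom setT;
  pmap : {linear submod_of pdom -> B} }.

HB.instance Definition _ A B := gen_eqMixin (pmorph A B).
HB.instance Definition _ A B := gen_choiceMixin (pmorph A B).

(* Two elements agree in the direct limit iff they have the same restriction to
   some essential submodule N contained in both domains. *)
Definition pmorph_sim A B (p q : pmorph A B) : Prop :=
  exists N : submodule A,
    [/\ essential N setT, N `<=` pdom p, N `<=` pdom q &
        forall (u : submod_of (pdom p)) (v : submod_of (pdom q)),
          submod_set N (val u) -> val u = val v -> pmap p u = pmap q v].

Definition pmorph_equiv A B : rel (pmorph A B) :=
  fun p q => `[< pmorph_sim p q >].

Lemma pmorph_equiv_refl A B : reflexive (@pmorph_equiv A B).
Proof.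
move=> p; apply/asboolP; exists (pdom p); split=> //.
  exact: pdom_essential.
by move=> u v _ /val_inj->.
Qed.

Lemma pmorph_equiv_sym A B : symmetric (@pmorph_equiv A B).
Proof.
have h p q : pmorph_equiv p q -> pmorph_equiv q p.
  move=> /asboolP[N [Ne Np Nq e]]; apply/asboolP.
  by exists N; split=> // u v Nu uv; rewrite (e v u) // -uv.
by move=> p q; apply/idP/idP; exact: h.
Qed.

Lemma pmorph_equiv_trans A B : transitive (@pmorph_equiv A B).
Proof.
move=> q p r /asboolP[N [Ne Np Nq e]] /asboolP[L [Le Lq Lr e']].
apply/asboolP.
exists (Submodule (submodI (submodP N) (submodP L))); split=> /=.
- exact: essentialI.
- by move=> x [/Np].
- by move=> x [_ /Lr].
move=> u w [Nu Lu] uw.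
have qu : val u \in (pdom q : set A) by apply/mem_set/Nq.
by rewrite (e u (Submod qu)) // (e' (Submod qu) w).
Qed.

Canonical pmorph_equiv_rel A B :=
  EquivRel (@pmorph_equiv A B) (@pmorph_equiv_refl A B)
    (@pmorph_equiv_sym A B) (@pmorph_equiv_trans A B).

Definition spec_hom A B := {eq_quot (@pmorph_equiv A B)}.

Definition ppreim A B (p : pmorph A B) (L : set B) : set A :=
  val @` (pmap p @^-1` L).

Lemma ppreim_essential A B (p : pmorph A B) (L : set B) :
  essential L setT -> essential (ppreim p L) setT.
Proof.
have [/submodE[P0 Pl] _ Pe] := pdom_essential p.
move=> [/submodE[Q0 Ql] _ Qe].
have Dm : is_submod (ppreim p L).
  apply/submodE; split=> [|r _ _ [u qu <-] [v qv <-]].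
    by exists 0; rewrite /= ?linear0.
  by exists (r *: u + v); rewrite /= ?linearP //; apply: Ql.
split=> // X Xm _ X0.
have [x [Px Xx] x0] := Pe X Xm (@subsetT _ X) X0.
move: (Xm) => /submodE[X00 Xl].
pose u := Submod (mem_set Px).
have [fu0|fu0] := eqVneq (pmap p u) 0.
  by exists x => //; split=> //; exists u => //=; rewrite fu0.
pose Y : set B := pmap p @` [set w | X (val w)].
have Ym : is_submod Y.
  apply/submodE; split=> [|r _ _ [v Xv <-] [w Xw <-]].
    by exists 0; rewrite /= ?linear0.
  by exists (r *: v + w); rewrite /= ?linearP //; apply: Xl.
have Y0 : nonzero Y by exists (pmap p u) => //; exists u.
have [y [Qy [w Xw wy]] y0] := Qe Y Ym (@subsetT _ Y) Y0.
rewrite -{}wy in Qy y0; exists (val w); first by split=> //; exists w.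
apply: contra_neq y0 => w0.
suff -> : w = 0 by rewrite linear0.
by apply: val_inj; rewrite w0 linear0.
Qed.

Section Composition.
Variables (A B C : rmodType R) (q : pmorph B C) (p : pmorph A B).

Lemma pcomp_dom_essential : essential (ppreim p (pdom q)) setT.
Proof. exact/ppreim_essential/pdom_essential. Qed.

Definition pcomp_dom : submodule A :=
  Submodule (let: And3 Dm _ _ := pcomp_dom_essential in Dm).

Lemma pcomp_subproof1 (x : submod_of pcomp_dom) :
  val x \in (pdom p : set A).
Proof. by case: x => x /= /set_mem[u _ <-]; exact: valP. Qed.

Lemma pcomp_subproof2 (x : submod_of pcomp_dom) :
  pmap p (Submod (pcomp_subproof1 x)) \in (pdom q : set B).
Proof.
have /set_mem[u qu ux] := valP x; apply: mem_set.
by congr (submod_set (pdom q) (pmap p _)): qu; apply: val_inj.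
Qed.

Definition pcomp_fun (x : submod_of pcomp_dom) : C :=
  pmap q (Submod (pcomp_subproof2 x)).

Lemma pcomp_fun_linear : linear pcomp_fun.
Proof.
move=> r x y; rewrite /pcomp_fun -linearP; congr (pmap q _); apply: val_inj.
by rewrite /= -linearP; congr (pmap p _); apply: val_inj.
Qed.

HB.instance Definition _ :=
  GRing.isLinear.Build R^c (submod_of pcomp_dom) C *:%R pcomp_fun
    pcomp_fun_linear.

Definition pcomp : pmorph A C :=
  @PMorph A C pcomp_dom pcomp_dom_essential pcomp_fun.
End Composition.

Definition spec_comp A B C (G : spec_hom B C) (F : spec_hom A B) :
    spec_hom A C :=
  \pi_(spec_hom A C) (pcomp (repr G) (repr F)).

Lemma spec_compE A B C (q : pmorph B C) (p : pmorph A B) :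
  spec_comp (\pi_(spec_hom B C) q) (\pi_(spec_hom A B) p) =
  \pi_(spec_hom A C) (pcomp q p).
Proof.
rewrite /spec_comp; apply/eqmodP => /=.
move: (reprK (\pi_(spec_hom B C) q)) (reprK (\pi_(spec_hom A B) p)).
move: (repr _) (repr _) => p' q' /eqmodP/asboolP[L [Le Lq' Lq eqq]].
move=> /eqmodP/asboolP[N [Ne Np' Np ep]]; apply/asboolP.
have Pe := ppreim_essential p Le.
have De := essentialI Pe Ne; have [Dm _ _] := De.
exists (Submodule Dm); split=> //=.
- move=> _ [[v Lv <-] Nv]; have v' := mem_set (Np' _ Nv).
  by exists (Submod v') => //=; rewrite (ep _ v) //; apply: Lq'.
- by move=> _ [[v Lv <-] Nv]; exists v => //; apply: Lq.
move=> u v [[w Lw wu] Nu] uv; rewrite /pcomp_fun.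
have e' : pmap p' (Submod (pcomp_subproof1 u)) = pmap p w by exact: ep.
have e'' : pmap p (Submod (pcomp_subproof1 v)) = pmap p w.
  by congr (pmap p _); apply: val_inj; rewrite /= -uv.
by apply: eqq; rewrite /= ?e' ?e''.
Qed.

Section Canonical.
Variables (A B : rmodType R) (f : {linear A -> B}).

Definition total_dom : submodule A := Submodule (@submodT R A).

Definition total_pmorph : pmorph A B :=
  @PMorph A B total_dom (@essentialT R A) (f \o \val).

Definition specP : spec_hom A B := \pi_(spec_hom A B) total_pmorph.
End Canonical.

Lemma specP_comp A B C (f : {linear A -> B}) (g : {linear B -> C}) :
  spec_comp (specP g) (specP f) = specP (g \o f).
Proof.
rewrite spec_compE; apply/eqmodP/asboolP; exists (total_dom A); split=> //=.
- exact: essentialT.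
- move=> x _; have Tx : x \in (total_dom A : set A) by rewrite inE.
  by exists (Submod Tx).
- by move=> u v _ uv; rewrite /pcomp_fun /= uv.
Qed.

Definition spec0 A B : spec_hom A B := specP (\0 : {linear A -> B}).

Definition is_kernel A B C (F : spec_hom A B) (G : spec_hom B C) : Prop :=
  spec_comp G F = spec0 A C /\
  forall (X : rmodType R) (H : spec_hom X B), spec_comp G H = spec0 X C ->
    exists! K : spec_hom X A, spec_comp F K = H.

Definition is_cokernel A B C (F : spec_hom A B) (G : spec_hom B C) : Prop :=
  spec_comp G F = spec0 A C /\
  forall (X : rmodType R) (H : spec_hom B X), spec_comp H F = spec0 A X ->
    exists! K : spec_hom C X, spec_comp K G = H.

(* In the abelian category Spec(Mod-R), 0 -> A -> B -> C -> 0 is a short exact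
   sequence when A -> B is a kernel of B -> C and B -> C is a cokernel of
   A -> B. *)
Definition spec_short_exact A B C (F : spec_hom A B) (G : spec_hom B C) :
    Prop :=
  is_kernel F G /\ is_cokernel F G.
End PartialMorphisms.

(* Main.v *)
(* A morphism of the spectral category is handled through the graph of a
   representative: a linear functional relation with essential domain.  With
   the element-wise criterion for essentiality (every x != 0 has a nonzero
   multiple in N), equality and composition in the spectral category become
   statements about multiples of elements, and the factorizations required by
   the universal properties are given by explicit graphs.  From (b), the kernel
   factorization of h is { (x, a) | h x = f a } and, for a complement B' of
   f(A), on which g is injective, the cokernel factorization of h is
   { (g b, h b) | b in B' }.  Conversely, given (a) and a complement B' of
   f(A), choose a complement X of g(B') in C: the projection of g(B') + X onto
   X vanishes after composition with P(g), hence is 0 in the spectral category,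
   which forces X = 0. *)

Require Import Defs.
From HB Require Import structures.
From mathcomp Require Import all_boot all_algebra all_classical.

Set Implicit Arguments.
Unset Strict Implicit.
Unset Printing Implicit Defensive.

Import GRing.Theory.
Local Open Scope ring_scope.
Local Open Scope classical_set_scope.

(* The homonyms seq.pmap and ssrfun.pcomp, imported last, would otherwise take
   precedence. *)
Local Notation pmap := Defs.pmap.
Local Notation pcomp := Defs.pcomp.

(** * Essential submodules and complements *)

Section Essential.
Context {R : nzRingType}.
Implicit Types M : rmodType R.

Lemma submod_scale M (N : set M) (r : R^c) x : is_submod N -> N x -> N (r *: x).
Proof.
by move=> /submodE[N0 Nl] Nx; rewrite -[r *: x]addr0; exact: Nl.
Qed.

Lemma submod_ker M M' (f : {linear M -> M'}) : is_submod (f @^-1` [set 0]).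
Proof.
apply/submodE; split=> [|r u v /= fu fv]; first exact: linear0.
by rewrite linearP fu fv scaler0 addr0.
Qed.

Lemma submod_image M M' (f : {linear M -> M'}) (N : set M) :
  is_submod N -> is_submod (f @` N).
Proof.
move=> /submodE[N0 Nl]; apply/submodE; split=> [|r _ _ [u Nu <-] [v Nv <-]].
  by exists 0 => //; exact: linear0.
by exists (r *: u + v); [exact: Nl | exact: linearP].
Qed.

Lemma submod_sum M (K L : set M) : is_submod K -> is_submod L ->
  is_submod [set k + c | k in K & c in L].
Proof.
move=> /submodE[K0 Kl] /submodE[L0 Ll]; apply/submodE; split.
  by exists 0 => //; exists 0; rewrite ?addr0.
move=> r _ _ [k Kk [c Lc <-]] [k' Kk' [c' Lc' <-]].
exists (r *: k + k'); first exact: Kl.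
exists (r *: c + c'); first exact: Ll.
by rewrite scalerDr addrACA.
Qed.

Lemma submod_cycle M (x : M) : is_submod (range ( *:%R^~ x : R^c -> M)).
Proof.
apply/submodE; split=> [|r _ _ [s _ <-] [t _ <-]].
  by exists 0 => //; rewrite scale0r.
by exists (r * s + t) => //; rewrite scalerA scalerDl.
Qed.

(** It is enough to test cyclic submodules, since a nonzero submodule contains the one generated by
    any of its nonzero elements. *)
Lemma essentialP M (N L : set M) : is_submod L ->
  essential N L <->
  [/\ is_submod N, N `<=` L &
      forall x, L x -> x != 0 -> exists2 r : R^c, N (r *: x) & r *: x != 0].
Proof.
move=> Lm; split=> -[Nm NL Ne]; split=> //.
  move=> x Lx x0.
  have [||y [Ny [r _ ry]] y0] := Ne _ (submod_cycle x).
    by move=> _ [r _ <-]; exact: submod_scale.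
    by exists x => //; exists 1; rewrite /= ?scale1r.
  by exists r; rewrite ry.
move=> X Xm XL [x Xx x0].
have [r Nrx rx0] := Ne x (XL x Xx) x0; exists (r *: x) => //; split=> //.
exact: submod_scale.
Qed.

Lemma essentialTP M (N : set M) :
  essential N setT <->
  is_submod N /\
  forall x, x != 0 -> exists2 r : R^c, N (r *: x) & r *: x != 0.
Proof.
split=> [/essentialP[|Nm _ Ne]|[Nm Ne]]; first exact: submodT.
  by split=> // x; exact: Ne.
by apply/essentialP; [exact: submodT | split=> // x _; exact: Ne].
Qed.

(** By Zorn's lemma, take [X] maximal among those meeting [K] only in 0. For [x] outside [X], the
    sum of [X] and the cyclic submodule of [x] meets [K] in a nonzero [k], which puts a nonzero
    multiple of [x] in the sum of [K] and [X]. *)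
Lemma complement_exists M (K : set M) :
  is_submod K -> exists X, complement K X.
Proof.
move=> Km; have /submodE[K0 _] := Km.
(* Linear combinations of two members only, so that the empty set, which is the
   union of the empty chain, qualifies. *)
pose P (X : set M) := (forall (r : R^c) u v, X u -> X v -> X (r *: u + v)) /\
  K `&` X `<=` [set 0].
have [F FP Ftot|X [[Xl KX] Xmax]] := @Zorn_bigcup M P.
  split=> [r u v [Y FY Yu] [Z FZ Zv]|x [Kx [Y FY Yx]]]; last first.
    by have [_] := FP Y FY; apply.
  have [YZ|ZY] := Ftot Y Z FY FZ.
    by exists Z => //; have [Zl _] := FP Z FZ; apply: Zl => //; exact: YZ.
  by exists Y => //; have [Yl _] := FP Y FY; apply: Yl => //; exact: ZY.
(* A nonempty [X] contains 0 as [- x + x], and an empty one would be properly contained in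
   [[set 0]]. *)
have X0 : X 0.
  apply: contrapT => nX0; apply: (Xmax [set 0]); last first.
    split=> [r u v -> ->|x []//].
    by rewrite scaler0 addr0.
  split=> [x Xx|/(_ 0 erefl)//]; case: nX0.
  by rewrite -(addNr x) -scaleN1r; exact: Xl.
have Xm : is_submod X by apply/submodE.
exists X; split=> //.
  by apply/seteqP; split=> // x ->.
apply/essentialTP; split=> [|x x0]; first exact: submod_sum.
have [Xx|nXx] := pselect (X x).
  by exists 1; rewrite scale1r //; exists 0 => //; exists x; rewrite ?add0r.
pose Y := [set c + d | c in X & d in range ( *:%R^~ x : R^c -> M)].
have /submodE[_ Yl] : is_submod Y.
  by apply: submod_sum => //; exact: submod_cycle.
have YX : X `<` Y.
  split=> [c Xc|/(_ x)YX].
    by exists c => //; exists 0; rewrite ?addr0//; exists 0; rewrite ?scale0r.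
  apply/nXx/YX; exists 0 => //; exists x; rewrite ?add0r//.
  by exists 1; rewrite ?scale1r.
have [k [Kk [c Xc [_ [r _ <-] krx]]] k0] : exists2 k, (K `&` Y) k & k <> 0.
  apply: contrapT => nKY; apply: (Xmax Y YX); split=> // k KYk.
  by apply: contrapT => k0; apply: nKY; exists k.
exists r.
  exists k => //; exists (- c); last by rewrite -krx addrAC subrr add0r.
  by rewrite -scaleN1r; exact: submod_scale.
apply/eqP => rx0; apply/k0/KX; split=> //.
by rewrite -krx rx0 addr0.
Qed.

End Essential.

(** * Graphs of partial morphisms and equality in the spectral category *)

Section Graphs.
Context {R : nzRingType}.
Implicit Types A B C : rmodType R.

Definition pgraph A B (p : pmorph A B) (x : A) (y : B) : Prop :=
  exists2 u, val u = x & pmap p u = y.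

Definition linear_rel A B (G : A -> B -> Prop) : Prop :=
  G 0 0 /\ forall (r : R^c) x y x' y',
    G x y -> G x' y' -> G (r *: x + x') (r *: y + y').

Lemma linear_rel_scale A B (G : A -> B -> Prop) (r : R^c) x y :
  linear_rel G -> G x y -> G (r *: x) (r *: y).
Proof.
by move=> [G0 Gl] Gxy; rewrite -[r *: x]addr0 -[r *: y]addr0; exact: Gl.
Qed.

Lemma linear_rel_add A B (G : A -> B -> Prop) x y x' y' :
  linear_rel G -> G x y -> G x' y' -> G (x + x') (y + y').
Proof.
by move=> [_ Gl] Gxy; rewrite -[x]scale1r -[y]scale1r; exact: Gl.
Qed.

Section Pgraph.
Variables (A B : rmodType R) (p : pmorph A B).

Lemma pgraph_linear : linear_rel (pgraph p).
Proof.
split=> [|r _ _ _ _ [u <- <-] [v <- <-]].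
  by exists 0; rewrite linear0.
by exists (r *: u + v); rewrite linearP.
Qed.

Lemma pgraph_fun x y y' : pgraph p x y -> pgraph p x y' -> y = y'.
Proof.
by move=> [u ux <-] [v vx <-]; congr (pmap p _); apply: val_inj; rewrite ux.
Qed.

Lemma pgraph_total x : x != 0 ->
  exists r : R^c, exists2 y, pgraph p (r *: x) y & r *: x != 0.
Proof.
have /essentialTP[_ pe] := pdom_essential p.
move=> /pe[r px rx0]; exists r.
by exists (pmap p (Submod (mem_set px))) => //; exists (Submod (mem_set px)).
Qed.

End Pgraph.

(** The elements on which [p] and [q] are both defined and agree form a submodule; the condition on
    multiples says that it is essential. *)
Lemma pgraph_piP A B (p q : pmorph A B) :
  \pi_(spec_hom A B)%qT p = \pi_(spec_hom A B)%qT q <->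
  forall x, x != 0 -> exists r : R^c,
    exists y, [/\ pgraph p (r *: x) y, pgraph q (r *: x) y & r *: x != 0].
Proof.
split=> [/eqmodP/asboolP[N [Ne Np Nq e]] x x0|pq].
  have /essentialTP[_ /(_ x x0)[r Nrx rx0]] := Ne.
  pose u := Submod (mem_set (Np _ Nrx)); pose v := Submod (mem_set (Nq _ Nrx)).
  exists r, (pmap p u); split=> //; first by exists u.
  by exists v => //; rewrite (e u v).
pose E : set A := [set x | exists2 y, pgraph p x y & pgraph q x y].
have Em : is_submod E.
  apply/submodE; split=> [|r x x' [y py qy] [y' py' qy']].
    by exists 0; have [] := pgraph_linear p; have [] := pgraph_linear q.
  exists (r *: y + y').
    by have [_] := pgraph_linear p; apply.
  by have [_] := pgraph_linear q; apply.
apply/eqmodP/asboolP; exists (Submodule Em); split=> /=.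
- apply/essentialTP; split=> // x /pq[r [y [py qy rx0]]].
  by exists r => //; exists y.
- by move=> x [y [u <- _] _]; exact/set_mem/valP.
- by move=> x [y _ [v <- _]]; exact/set_mem/valP.
move=> u v [y py qy] uv.
have -> : pmap p u = y by apply: (pgraph_fun _ py); exists u.
by apply: (pgraph_fun qy); exists v.
Qed.

Lemma pgraph_pcomp A B C (q : pmorph B C) (p : pmorph A B) x z :
  pgraph (pcomp q p) x z <-> exists2 y, pgraph p x y & pgraph q y z.
Proof.
split=> [[u <- <-]|[_ [u <- <-] [v vu <-]]].
  exists (pmap p (Submod (pcomp_subproof1 u))).
    by exists (Submod (pcomp_subproof1 u)).
  by exists (Submod (pcomp_subproof2 u)).
have du : val u \in (pcomp_dom q p : set A).
  by apply/mem_set; exists u => //=; rewrite -vu; exact: set_mem (valP v).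
exists (Submod du) => //=; rewrite /pcomp_fun; congr (pmap q _); apply: val_inj.
by rewrite /= vu; congr (pmap p _); exact: val_inj.
Qed.

Lemma pgraph_total_pmorph A B (f : {linear A -> B}) x y :
  pgraph (total_pmorph f) x y <-> y = f x.
Proof.
split=> [[u <- <-]//|->].
have Tx : x \in (total_dom A : set A) by rewrite inE.
by exists (Submod Tx).
Qed.

(** Linearity reduces single-valuedness to the fibre over 0, and the last hypothesis makes the
    domain of [G] essential. *)
Lemma pmorph_of_graph A B (G : A -> B -> Prop) :
    linear_rel G -> (forall y, G 0 y -> y = 0) ->
    (forall x, x != 0 ->
      exists r : R^c, exists2 y, G (r *: x) y & r *: x != 0) ->
  exists p : pmorph A B, forall x y, pgraph p x y <-> G x y.
Proof.
move=> [G0 Gl] Gfun0 Gdom.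
have Gfun x y y' : G x y -> G x y' -> y = y'.
  move=> Gy Gy'; apply/eqP; rewrite -subr_eq0; apply/eqP/Gfun0.
  by rewrite -(addNr x) [y - y']addrC -(scaleN1r x) -(scaleN1r y'); exact: Gl.
pose D : set A := [set x | exists y, G x y].
have Dm : is_submod D.
  apply/submodE; split=> [|r u v [y Gy] [z Gz]]; first by exists 0.
  by exists (r *: y + z); exact: Gl.
have De : essential D setT.
  apply/essentialTP; split=> // x /Gdom[r [y Gy rx0]].
  by exists r => //; exists y.
(* The value 0 outside [D] is arbitrary. *)
have /choice[k kP] : forall x, exists y, D x -> G x y.
  by move=> x; have [[y Gy]|nD] := pselect (D x); [exists y | exists 0].
pose S := Submodule Dm.
have SG (u : submod_of S) : G (val u) (k (val u)).
  by apply: kP; exact/(set_mem (valP u)).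
have kl : linear (fun u : submod_of S => k (val u)).
  by move=> r u v; apply: Gfun (SG _) _; rewrite linearP; apply: Gl; exact: SG.
pose kL := GRing.isLinear.Build R^c (submod_of S) B *:%R _ kl.
pose kk : {linear submod_of S -> B} :=
  HB.pack (fun u : submod_of S => k (val u)) kL.
exists (@PMorph R A B S De kk) => x y; split=> [[u <- <-]|Gxy]; first exact: SG.
have Dx : x \in (S : set A) by apply/mem_set; exists y.
by exists (Submod Dx) => //=; apply: Gfun Gxy; exact: kP (set_mem Dx).
Qed.

Lemma spec_comp_eqP A B C (q : pmorph B C) (p : pmorph A B) (h : pmorph A C) :
  spec_comp (\pi_(spec_hom B C)%qT q) (\pi_(spec_hom A B)%qT p) =
    \pi_(spec_hom A C)%qT h <->
  forall x, x != 0 -> exists r : R^c, exists y, exists z,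
    [/\ pgraph p (r *: x) y, pgraph q y z, pgraph h (r *: x) z & r *: x != 0].
Proof.
rewrite spec_compE; split=> [/pgraph_piP H x /H[r [z []]]|H].
  by move=> /pgraph_pcomp[y py qz] hz rx0; exists r, y, z.
apply/pgraph_piP => x /H[r [y [z [py qz hz rx0]]]]; exists r, z; split=> //.
by apply/pgraph_pcomp; exists y.
Qed.

Lemma specP_comp_eq A B C (g : {linear B -> C}) (f : {linear A -> B})
    (h : {linear A -> C}) :
  (forall x, g (f x) = h x) -> spec_comp (specP g) (specP f) = specP h.
Proof.
move=> gfh; apply/spec_comp_eqP => x x0; exists 1, (f x), (h x).
by rewrite scale1r; split=> //; apply/pgraph_total_pmorph; rewrite ?gfh.
Qed.

End Graphs.

(** For the direct implication, cancel [f] between the inclusion of its kernel and the zero map. *)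
Lemma linear_injP (R : nzRingType) (A B : rmodType R) (f : {linear A -> B}) :
  is_mono f <-> forall x, f x = 0 -> x = 0.
Proof.
split=> [fm x fx0|finj X u v fuv x].
  pose K := Submodule (submod_ker f).
  have Kx : x \in (K : set A) by exact: mem_set.
  apply: (fm (submod_of K) \val \0 _ (Submod Kx)).
  by apply/funext => u /=; rewrite linear0; exact: (set_mem (valP u)).
apply/eqP; rewrite -subr_eq0; apply/eqP/finj.
by rewrite linearB (congr1 (@^~ x) fuv : f (u x) = f (v x)) subrr.
Qed.

(** * Kernel and cokernel conditions in terms of [f] and [g] *)

Section ShortExact.
Variables (R : nzRingType) (A B C : rmodType R).
Variables (f : {linear A -> B}) (g : {linear B -> C}).
Hypothesis gf0 : forall x, g (f x) = 0.

(** Both the inclusion of the kernel of [f] and the zero map factor 0 through [specP f], so they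
    agree in the spectral category; a nonzero [x] in the kernel would then have a nonzero multiple
    equal to 0. *)
Lemma kernel_inj : is_kernel (specP f) (specP g) -> forall x, f x = 0 -> x = 0.
Proof.
move=> [_ ker] x fx0; pose K := Submodule (submod_ker f).
have Kf (u : submod_of K) : f (val u) = 0 by exact: (set_mem (valP u)).
have [|k [_ kuniq]] := ker (submod_of K) (spec0 _ _).
  by apply: specP_comp_eq => u; exact: linear0.
have e : specP (\val : {linear submod_of K -> A}) = spec0 _ _.
  rewrite -(kuniq (specP \val)); first apply: kuniq.
    by apply: specP_comp_eq => u; exact: linear0.
  exact: specP_comp_eq.
have Kx : x \in (K : set A) by exact: mem_set.
apply: contrapT => /eqP x0.
have /pgraph_piP/(_ (Submod Kx))[|r [y []]] := e.
  by apply: contra_neq x0 => /(congr1 val).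
move=> /pgraph_total_pmorph -> /pgraph_total_pmorph/= rx0.
by case/eqP; apply: val_inj; rewrite /= rx0.
Qed.

(** The inclusion of the kernel of [g] factors through [specP f], which gives each nonzero [x] in it
    a nonzero multiple in the image of [f]. *)
Lemma kernel_essential :
  is_kernel (specP f) (specP g) -> essential (range f) (g @^-1` [set 0]).
Proof.
move=> [_ ker]; apply/essentialP; first exact: submod_ker.
split=> [|_ [x _ <-]|x gx0 x0]; [|exact: gf0|].
  exact/submod_image/submodT.
pose K := Submodule (submod_ker g).
have Kg (u : submod_of K) : g (val u) = 0 by exact: (set_mem (valP u)).
have [|k [kP _]] := ker (submod_of K) (specP \val).
  exact: specP_comp_eq.
have Kx : x \in (K : set B) by exact: mem_set.
move: k kP; apply: quotW => k /spec_comp_eqP/(_ (Submod Kx))[|r [a [y []]]].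
  by apply: contra_neq x0 => /(congr1 val).
move=> _ /pgraph_total_pmorph -> /pgraph_total_pmorph/= fa rx0.
exists r; first by exists a.
by apply: contra_neq rx0 => rx0; exact: val_inj.
Qed.

Lemma cokernel_essential (B' : set B) : is_cokernel (specP f) (specP g) ->
  complement (range f) B' -> essential (g @` B') [set: C].
Proof.
move=> [_ coker] [B'm _ /essentialTP[_ Be]].
have Dm := submod_image g B'm; have /submodE[D0 Dl] := Dm.
have [X [Xm DX /essentialTP[_ DXe]]] := complement_exists Dm.
have /submodE[X0 Xl] := Xm.
(* The relation is the projection onto [X] along the image of [B']. *)
have [||x|p pP] := @pmorph_of_graph R C C (fun x y => X y /\ (g @` B') (x - y)).
- split=> [|r x y x' y' [Xy Dxy] [Xy' Dxy']]; first by rewrite subr0.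
  split; first exact: Xl.
  by rewrite opprD addrACA -scalerBr; exact: Dl.
- move=> y [Xy Dy]; suff : (g @` B' `&` X) y by rewrite DX.
  by split=> //; have := submod_scale (-1) Dm Dy; rewrite scaleN1r opprB subr0.
- move=> /DXe[r [d Dd [c Xc dc]] rx0]; exists r, c => //; split=> //.
  by rewrite -dc addrK.
have [|k [_ kuniq]] := coker C (spec0 _ _).
  exact: specP_comp_eq.
have /pgraph_piP p0 : \pi_(spec_hom C C)%qT p = spec0 C C.
  rewrite -(kuniq (\pi_(spec_hom C C)%qT p)); first apply: kuniq.
    exact: specP_comp_eq.
  (* A nonzero multiple of [b] has the form [f a + b']; [g] sends it to [g b'], where the projection
     vanishes. *)
  apply/spec_comp_eqP => b /Be[r [_ [a _ <-] [b' B'b' rb]] rb0].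
  exists r, (g (r *: b)), 0; split=> //; try exact/pgraph_total_pmorph.
  apply/pP; split=> //; rewrite subr0 -rb linearD gf0 add0r.
  by exists b'.
have X_eq0 x : X x -> x = 0.
  move=> Xx; apply: contrapT => /eqP /p0[r [y [/pP[_]]]].
  move=> /[swap] /pgraph_total_pmorph -> /=; rewrite subr0 => Drx.
  apply/negP; rewrite negbK; apply/eqP.
  suff : (g @` B' `&` X) (r *: x) by rewrite DX.
  by split=> //; exact: submod_scale.
apply/essentialTP; split=> // x /DXe[r [d Dd [c /X_eq0 ->]]].
by rewrite addr0 => dr rx0; exists r; rewrite -?dr // dr.
Qed.

Lemma kernel_of_essential : (forall x, f x = 0 -> x = 0) ->
  essential (range f) (g @^-1` [set 0]) -> is_kernel (specP f) (specP g).
Proof.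
move=> finj /essentialP[|_ _ fe]; first exact: submod_ker.
split=> [|X]; first exact: specP_comp_eq.
apply: quotW => h /spec_comp_eqP hg0.
have hl := pgraph_linear h; have [h0 hlin] := hl.
have [||x|k kP] := @pmorph_of_graph R X A (fun x a => pgraph h x (f a)).
- split=> [|r x a x' a' ha ha']; first by rewrite linear0.
  by rewrite linearP; exact: hlin.
- by move=> a ha; apply/finj/(pgraph_fun ha).
- move=> /hg0[r [y [z [hy]]]].
  move=> /pgraph_total_pmorph -> /pgraph_total_pmorph/= gy rx0.
  (* Here [g y = 0], so a nonzero [y] has a nonzero multiple [f a]; as [h] is single-valued, the
     same multiple of [r *: x] is nonzero. *)
  have [y0|y0] := eqVneq y 0.
    by exists r, 0 => //; rewrite linear0 -y0.
  have [s [a _ fa] sy0] := fe y gy y0.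
  have hs := linear_rel_scale s hl hy.
  exists (s * r), a; rewrite -scalerA ?fa//.
  apply: contra_neq sy0 => srx0; rewrite srx0 in hs.
  exact: pgraph_fun hs h0.
exists (\pi_(spec_hom X A)%qT k); split.
  apply/spec_comp_eqP => x /(pgraph_total k)[r [a ka rx0]].
  exists r, a, (f a); split=> //; first exact/pgraph_total_pmorph.
  exact/kP.
apply: quotW => k' /spec_comp_eqP k'P; apply/pgraph_piP => x /k'P.
move=> [r [a [y [k'a /pgraph_total_pmorph -> hy rx0]]]].
by exists r, a; split=> //; exact/kP.
Qed.

Lemma cokernel_of_essential (B' : set B) : (forall x, f x = 0 -> x = 0) ->
  essential (range f) (g @^-1` [set 0]) -> complement (range f) B' ->
  essential (g @` B') [set: C] -> is_cokernel (specP f) (specP g).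
Proof.
move=> finj /essentialP[|_ _ fe]; first exact: submod_ker.
move=> [B'm fB' /essentialTP[_ Be]] /essentialTP[_ Ce].
have /submodE[B'0 B'l] := B'm.
(* A nonzero [b] in [B'] killed by [g] would have a nonzero multiple in both [B'] and the image of
   [f]. *)
have ginj b : B' b -> g b = 0 -> b = 0.
  move=> B'b gb0; apply: contrapT => /eqP /(fe b gb0)[r fr].
  apply/negP; rewrite negbK; apply/eqP.
  suff : (range f `&` B') (r *: b) by rewrite fB'.
  by split=> //; exact: submod_scale.
split=> [|X]; first exact: specP_comp_eq.
apply: quotW => h /spec_comp_eqP hf0.
have hl := pgraph_linear h; have [h0 hlin] := hl.
have [||y|k kP] := @pmorph_of_graph R C X
  (fun y z => exists2 b, B' b & g b = y /\ pgraph h b z).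
- split=> [|r _ z _ z' [b B'b [<- hb]] [b' B'b' [<- hb']]].
    by exists 0; rewrite ?linear0.
  exists (r *: b + b'); first exact: B'l.
  by rewrite linearP; split=> //; exact: hlin.
- by move=> z [b B'b [/(ginj b B'b) -> hz]]; exact: pgraph_fun hz h0.
(* First [r] moves [y] to some [g b], then [s] moves [b] into the domain of [h]; injectivity of [g]
   on [B'] keeps the result nonzero. *)
- move=> /Ce[r [b B'b gb] ry0].
  have [|s [z hz sb0]] := @pgraph_total _ _ _ h b.
    by apply: contra_neq ry0 => b0; rewrite -gb b0 linear0.
  have B'sb : B' (s *: b) by exact: submod_scale.
  exists (s * r), z; rewrite -scalerA -gb -linearZ; last first.
    by apply: contra_neq sb0; exact: ginj.
  by exists (s *: b).
exists (\pi_(spec_hom C X)%qT k); split; last first.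
  apply: quotW => k' /spec_comp_eqP k'P; apply/pgraph_piP.
  move=> y /Ce[r [b B'b gb] ry0].
  have [|s [_ [z [/pgraph_total_pmorph -> k'z hz sb0]]]] := k'P b.
    by apply: contra_neq ry0 => b0; rewrite -gb b0 linear0.
  have B'sb : B' (s *: b) by exact: submod_scale.
  exists (s * r), z; rewrite -scalerA -gb -linearZ; split=> //.
    by apply/kP; exists (s *: b).
  by apply: contra_neq sb0; exact: ginj.
(* A nonzero b has a nonzero multiple f a + b' with h (f a) = 0 and b' in the
   domain of h; there both maps take the value h b'. *)
apply/spec_comp_eqP => b b0.
suff [r [a [b' [z [rb B'b' ha hb' rb0]]]]] : exists r : R^c, exists a b' z,
    [/\ r *: b = f a + b', B' b', pgraph h (f a) 0, pgraph h b' z &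
        r *: b != 0].
  exists r, (g (r *: b)), z; split=> //; first exact/pgraph_total_pmorph.
    by apply/kP; exists b' => //; rewrite rb linearD gf0 add0r.
  by rewrite rb -[z]add0r; exact: linear_rel_add.
have [r [_ [a _ <-] [b' B'b' rb]] rb0] := Be b b0.
(* For [a != 0], [s] comes from the vanishing of [h] after [specP f]; if [s *: (r *: b)] were 0,
   then [f (s *: a)] would lie in [B'], forcing [s *: a = 0]. *)
have [s [ha sb0]] : exists s : R^c,
    pgraph h (f (s *: a)) 0 /\ s *: (r *: b) != 0.
  have [a0|a0] := eqVneq a 0.
    by exists 1; rewrite a0 scaler0 linear0 scale1r.
  have [s [_ [z [/pgraph_total_pmorph -> hz /pgraph_total_pmorph/= z0 sa0]]]] :=
    hf0 a a0.
  exists s; split; first by rewrite -z0.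
  apply: contra_neq sa0; rewrite -rb scalerDr -linearZ => /eqP.
  rewrite addr_eq0 => /eqP fsa; apply: finj.
  suff : (range f `&` B') (f (s *: a)) by rewrite fB'.
  split=> //; rewrite fsa -scalerN -scaleN1r.
  by do 2! apply: (submod_scale _ B'm).
(* A further [t] brings a nonzero [s *: b'] into the domain of [h]. *)
have [b'0|b'0] := eqVneq (s *: b') 0.
  exists (s * r), (s *: a), 0, 0; rewrite -scalerA; split=> //.
  by rewrite -rb scalerDr b'0 linearZ.
have [t [z hz tb0]] := pgraph_total h b'0.
exists (t * (s * r)), (t *: (s *: a)), (t *: (s *: b')), z.
have e : (t * (s * r)) *: b = f (t *: (s *: a)) + t *: (s *: b').
  by rewrite -!scalerA -rb !scalerDr !linearZ.
have B't : B' (t *: (s *: b')) by do 2! apply: (submod_scale _ B'm).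
split=> //.
  by rewrite linearZ -(scaler0 _ t); exact: linear_rel_scale.
apply: contra_neq tb0; rewrite e addrC => /eqP; rewrite addr_eq0 => /eqP tb.
suff : (range f `&` B') (t *: (s *: b')) by rewrite fB'.
by split=> //; rewrite tb -linearN; eexists.
Qed.

End ShortExact.

Theorem proposition2p2 (R : nzRingType) (A B C : rmodType R)
    (f : {linear A -> B}) (g : {linear B -> C}) :
  (forall x, g (f x) = 0) ->
  spec_short_exact (specP f) (specP g) <->
  [/\ is_mono f,
      essential (range f) (g @^-1` [set 0]) &
      forall B' : set B, complement (range f) B' ->
        essential (g @` B') [set: C]].
Proof.
move=> gf0; split=> [[ker coker]|[/linear_injP finj fe Ce]].
  split=> [||B' fB'].
  - exact/linear_injP/(kernel_inj ker).
  - exact: kernel_essential.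
  - exact: (cokernel_essential gf0 coker).
split; first exact: kernel_of_essential.
(* The condition on complements is universal, so a complement has to be produced. *)
have [B' fB'] : exists B', complement (range f) B'.
  exact/complement_exists/submod_image/submodT.
exact: (cokernel_of_essential gf0 finj fe fB' (Ce B' fB')).
Qed.
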